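(* Every square-free graph with at most $16$ vertices is 101-colourable. Moreover, up to isomorphism there is exactly one square-free graph with $17$ vertices that is not 101-colourable.
   Context: A graph is square-free if it contains no 4-cycle as a (not necessarily induced) subgraph. A finite simple undirected graph is 101-colourable if there is an assignment of a value in $\{0,1\}$ to each vertex such that (i) no two adjacent vertices are both assigned $0$, and (ii) no triangle (3-clique) has all three vertices assigned $1$. *)

(* Defs.v *)
From mathcomp Require Import all_boot.
Set Implicit Arguments. Unset Strict Implicit. Unset Printing Implicit Defensive.

Definition simple_graph (T : finType) (e : rel T) : Prop :=
  symmetric e /\ irreflexive e.

Definition square_free (T : finType) (e : rel T) : Prop :=
  forall a b c d : T,
    [&& a != b, a != c, a != d, b != c, b != d & c != d] ->
    ~~ [&& e a b, e b c, e c d & e d a].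

(* 101-colourable: an assignment f : T -> bool, where false encodes 0 and
   true encodes 1, such that (i) no two adjacent vertices are both 0 and
   (ii) no triangle has all three vertices equal to 1. *)
Definition colourable101 (T : finType) (e : rel T) : Prop :=
  exists f : T -> bool,
    (forall x y : T, e x y -> f x || f y) /\
    (forall x y z : T, e x y -> e y z -> e z x -> ~~ [&& f x, f y & f z]).

Definition graph_iso (T U : finType) (e : rel T) (e' : rel U) : Prop :=
  exists f : T -> U, bijective f /\ forall x y : T, e' (f x) (f y) = e x y.

(* Main.v *)
From Stdlib Require Import BinNums BinNat.
Require Import Defs.
From mathcomp Require Import all_boot.
Set Implicit Arguments. Unset Strict Implicit. Unset Printing Implicit Defensive.

(* In a square-free graph two triangles share at most one vertex, and two vertices
   of a triangle T are joined by no other walk of length at most 3. Hence adding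
   the triangles one at a time, each new one through points that are pairwise at
   distance at least 4 in the union of the previous ones, produces few systems of
   triangles on at most 17 points up to isomorphism: about 600, none with 12
   triangles. A 0/1-assignment is good as soon as its zeros meet every triangle
   and are independent, so for a fixed system of all triangles the graph is not
   colourable iff its remaining edges spoil every independent transversal. Each
   remaining edge again joins points at distance at least 4 in the rest, and a
   backtracking search over these edges leaves a single graph, with 11 triangles
   and 2 further edges. *)

(** * Search for uncolourable graphs *)

Fixpoint join (s t : bitseq) : bitseq :=
  match s, t with
  | [::], _ => t
  | _, [::] => s
  | b :: s', c :: t' => (if b then true else c) :: join s' t'
  end.

Fixpoint meet (s t : bitseq) : bool :=
  match s, t with
  | b :: s', c :: t' => if (if b then c else false) then true else meet s' t'
  | _, _ => false
  end.

Definition matrix := seq bitseq.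
Definition row (Y : matrix) a : bitseq := nth [::] Y a.
Definition entry (Y : matrix) a b : bool := nth false (row Y a) b.
(* Adjacency matrices are lists of rows in which missing entries mean [false]. *)
Definition mark (Y : matrix) a b : matrix :=
  set_nth [::] Y a (set_nth false (row Y a) b true).
Definition mark2 (Y : matrix) a b : matrix := mark (mark Y a b) b a.

(** A Boolean matrix product: row [a] is the union of the rows of the neighbours of [a], which
    [mask] picks out. *)
Definition square (Y : matrix) : matrix :=
  [seq foldr join [::] (mask r Y) | r <- Y].

(* With [Y2 = square Y]: no walk of length at most 3 from [a] to [b]. The nested
   conditionals, here and below, keep the evaluation short-circuiting. *)
Definition far (Y Y2 : matrix) a b : bool :=
  if eqn a b then false else
  if entry Y a b then false else
  if meet (row Y a) (row Y b) then false else
  ~~ meet (row Y a) (row Y2 b).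

Definition pairs_of (s : seq nat) : seq (nat * nat) :=
  let fix go s := if s is x :: s' then [seq (x, y) | y <- s'] ++ go s' else [::]
  in go s.

(** * Systems of triangles and their extensions by one triangle *)

Definition system := seq (seq nat).

Definition graph_of (r : system) : matrix :=
  foldr (fun T Y => foldr (fun ab Y => mark2 Y ab.1 ab.2) Y (pairs_of T)) [::] r.

(** Candidates for the old points of a new triangle. Sets with fewer than [k] points, even the empty
    one, are listed too, since fresh points can complete them. *)
Fixpoint far_sets (fr : nat -> nat -> bool) k (s : seq nat) : seq (seq nat) :=
  if s is x :: s' then
    if k is k'.+1 then
      [seq x :: u | u <- far_sets fr k' s' & all (fr x) u] ++ far_sets fr k s'
    else [:: [::]]
  else [:: [::]].

Definition degrees (r : system) : seq nat :=
  foldr (fun T D => foldr (fun x D => incr_nth D x) D T) [::] r.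
Definition weight (D : seq nat) (T : seq nat) := foldr (fun x n => nth 0 D x + n) 0 T.

(* The points of a system are 0, ..., p-1. Only extensions in which the new triangle
   has least total degree are kept: some triangle always does, and deleting it
   leaves a smaller system to extend. *)
Definition extensions (p : nat) (r : system) : seq (nat * system) :=
  let Y := graph_of r in let Y2 := square Y in
  let F := [seq [seq far Y Y2 a b | b <- iota 0 p] | a <- iota 0 p] in
  let D := degrees r in
  flatten [seq
    let q := p + (3 - size u) in
    let T := u ++ iota p (3 - size u) in
    if q <= 17 then
      let D' := foldr (fun x D => incr_nth D x) D T in
      let w := weight D' T in
      if all (fun T' => w <= weight D' T') r then [:: (q, T :: r)] else [::]
    else [::] | u <- far_sets (entry F) 3 (iota 0 p)].

(* A heuristic canonical labelling by hashing and individualisation. Nothing is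
   assumed of it: [relabel] checks that the answer is a permutation, and a poor
   labelling would only leave isomorphic duplicates in a level. The numeric
   constants are arbitrary. *)
Fixpoint low_bits (n : nat) (x : positive) : N :=
  match n with
  | 0 => N0
  | n'.+1 => match x with
    | xH => Npos xH
    | xO x' => match low_bits n' x' with N0 => N0 | Npos y => Npos (xO y) end
    | xI x' => match low_bits n' x' with N0 => Npos xH | Npos y => Npos (xI y) end
    end
  end.
Definition low12 (x : N) := match x with N0 => N0 | Npos y => low_bits 12 y end.
Definition scramble (x : N) :=
  match x with N0 => Npos xH | Npos y => Npos (xO (xI (xO y))) end.
Fixpoint add_at (h : seq N) x (d : N) : seq N :=
  match h, x with
  | a :: h', 0 => low12 (N.add a d) :: h'
  | a :: h', x'.+1 => a :: add_at h' x' d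
  | [::], _ => [::]
  end.
Definition hash_step (r : system) (h : seq N) : seq N :=
  foldr (fun T h' =>
    let s := foldr (fun x a => N.add (nth N0 h x) a) N0 T in
    let m := low12 (N.lxor s (scramble s)) in
    foldr (fun x h' => add_at h' x m) h' T) h r.
Fixpoint insert_key (a : N * nat) (s : seq (N * nat)) :=
  if s is b :: s' then if N.leb a.1 b.1 then a :: s else b :: insert_key a s' else [:: a].
Definition order_of (h : seq N) := foldr insert_key [::] (zip h (iota 0 (size h))).
Fixpoint first_tie (s : seq (N * nat)) : option nat :=
  match s with
  | a :: ((b :: _) as s') => if N.eqb a.1 b.1 then Some a.2 else first_tie s'
  | _ => None
  end.
Fixpoint split_ties n (r : system) (h : seq N) : seq nat :=
  let o := order_of h in
  if n is n'.+1 then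
    if first_tie o is Some v then split_ties n' r (hash_step r (hash_step r (add_at h v 1789%num)))
    else [seq a.2 | a <- o]
  else [seq a.2 | a <- o].
(* The points of degree 1 in a triangle are interchangeable, so they get distinct
   hashes from the start. *)
Definition hash_init (p : nat) (r : system) : seq N :=
  let D := degrees r in
  foldr (fun T h => 
     (foldr (fun x hk => if nth 0 D x == 1 then (add_at hk.1 x hk.2, N.add hk.2 37%num) else hk) (h, 37%num) T).1)
     (nseq p 1%num) r.
Definition labelling (p : nat) (r : system) : seq nat :=
  split_ties 17 r (hash_step r (hash_step r (hash_step r (hash_init p r)))).

Fixpoint lex_le (s t : seq nat) : bool :=
  match s, t with
  | x :: s', y :: t' => if eqn x y then lex_le s' t' else x <= y
  | [::], _ => true
  | _, [::] => false
  end.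
Definition is_order (p : nat) (o : seq nat) : bool :=
  if eqn (size o) p then if uniq o then all (fun i => i < p) o else false else false.
Definition relabel (pr : nat * system) : nat * system :=
  let: (p, r) := pr in
  let o := labelling p r in
  if is_order p o then
    (p, sort lex_le [seq sort leq [seq index x o | x <- T] | T <- r])
  else (p, r).

Fixpoint add_new (x : nat * system) (L : seq (nat * system)) :=
  if L is y :: L' then if x.2 == y.2 then if x.1 == y.1 then L else y :: add_new x L' else y :: add_new x L' else [:: x].
Definition next_level (L : seq (nat * system)) : seq (nat * system) :=
  foldl (fun L' x => add_new x L') [::] [seq relabel x | x <- flatten [seq extensions y.1 y.2 | y <- L]].

(* A colouring is represented by its set of zeros. *)
Fixpoint colourings (Y : matrix) (r : system) : seq (seq nat) :=
  if r is T :: r' then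
    flatten [seq if has (fun x => has (eqn x) z) T then [:: z]
                 else [seq x :: z | x <- T & ~~ has (entry Y x) z] | z <- colourings Y r']
  else [:: [::]].

(** The assignment with zeros [z] can fail only through an edge inside [z]: either a known one, or
    one between far points that is not yet excluded. *)
Definition options (Y Y2 X : matrix) (z : seq nat) : seq (nat * nat) :=
  [seq ab <- pairs_of z |
     if entry X ab.1 ab.2 then false else
     if entry Y ab.1 ab.2 then true else far Y Y2 ab.1 ab.2].

(* A choice of branching; any [n] is sound. *)
Fixpoint cheapest (opts : seq nat -> seq (nat * nat)) n best zs :=
  match n, zs with
  | n'.+1, z :: zs' =>
     if size best <= 1 then best else
     let o := opts z in
     cheapest opts n' (if size o < size best then o else best) zs'
  | _, _ => best
  end.

(* The transposition of [a] and [b] is an automorphism of [Y]. *)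
Definition alike (Y : matrix) a b : bool :=
  all (fun u => if eqn u a then true else if eqn u b then true
                else eqb (entry Y a u) (entry Y b u))
    (iota 0 (maxn (size (row Y a)) (size (row Y b)))).

Definition twins (r : system) : seq (nat * nat) :=
  [seq ab <- flatten [seq [seq (a, b) | a <- T, b <- T] | T <- r] |
     if eqn ab.1 ab.2 then false else
     all (fun T => eqb (has (eqn ab.1) T) (has (eqn ab.2) T)) r].

Definition swap_pairs (tw : seq (nat * nat)) (Y X : matrix) (a b : nat) :=
  [seq (ab.2, b) | ab <- tw &
     if eqn ab.1 a then if alike Y a ab.2 then alike X a ab.2 else false else false].

Definition marks X (l : seq (nat * nat)) : matrix :=
  foldr (fun ab X => mark2 X ab.1 ab.2) X l.

(** The labelling is the one at which the search arrives, because [accept] compares matrices entry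
    by entry and does not test isomorphism. *)
Definition base : system :=
  [:: [:: 0; 3; 8]; [:: 0; 5; 14]; [:: 1; 2; 6]; [:: 1; 10; 16]; [:: 2; 8; 13];
      [:: 3; 7; 11]; [:: 4; 7; 10]; [:: 4; 14; 15]; [:: 5; 9; 16]; [:: 9; 11; 12];
      [:: 12; 13; 15]].
Definition witness : matrix := marks (graph_of base) [:: (6, 11); (6, 14)].

(** Reached when no listed colouring is left. Since no pair is far, no edge can be added to [Y], so
    the graph is known completely. *)
Definition accept p (Y : matrix) : bool :=
  if 17 <= p then
    let Y2 := square Y in
    all (fun a => all (fun b =>
      if eqb (entry Y a b) (entry witness a b) then ~~ far Y Y2 a b else false)
      (iota 0 17)) (iota 0 17)
  else false.

Definition separates a b (z : seq nat) : bool :=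
  if has (eqn a) z then ~~ has (eqn b) z else true.

(* [Y] holds the known edges, [X] the known non-edges, [zs] the colourings of the
   system that are still proper for [Y]. Some pair in the zero set of a colouring
   has to be an edge; once a pair is refuted, so are its images under the
   transpositions of interchangeable points. *)
Fixpoint solve p tw n (Y X : matrix) (zs : seq (seq nat)) {struct n} : bool :=
  if n is n'.+1 then
    if zs is z :: zs' then
      let Y2 := square Y in
      (fix branch X o := if o is (a, b) :: o' then
         if entry X a b then branch X o' else
         if solve p tw n' (mark2 Y a b) X (filter (separates a b) zs) then
           branch (marks X ((a, b) :: swap_pairs tw Y X a b ++ swap_pairs tw Y X b a)) o'
         else false
       (* Running through all options settles the node, as one of them must be an edge. At most 30
          further colourings are compared to find a short list. *)
       else true) X (cheapest (options Y Y2 X) 30 (options Y Y2 X z) zs')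
    else accept p Y
  else false.

Definition solve_system (pr : nat * system) : bool :=
  let: (p, r) := pr in
  let Y := graph_of r in
  (* Small zero sets come first, as they leave few pairs to branch on; 40 bounds the depth of the
     recursion. *)
  solve p (twins r) 40 Y [::] (sort (fun s t => size s <= size t) (colourings Y r)).

(** Each round settles the systems with one more triangle. Success means reaching an empty level;
    running out of rounds counts as failure. *)
Fixpoint run n L :=
  if n is n'.+1 then
    if all solve_system L then if L is [::] then true else run n' (next_level L) else false
  else false.

(** * Lists and matrices *)

Lemma nth_join s t i : nth false (join s t) i = nth false s i || nth false t i.
Proof.
by elim: s t i => [|b s IH] [|c t] [|i] //=; rewrite ?orbF ?nth_nil.
Qed.

Lemma meetP s t : reflect (exists i, nth false s i && nth false t i) (meet s t).
Proof.
elim: s t => [|b s IH] [|c t] /=; try by apply: ReflectF => -[i]; rewrite !nth_nil ?andbF.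
case: ifP => bc; first by apply: ReflectT; exists 0; move: bc; case: b.
apply: (iffP (IH t)) => -[i]; first by exists i.+1.
by case: i => [|i] /=; [move: bc; case: b => //= -> | exists i].
Qed.

Lemma entry_mark Y a b u v : entry (mark Y a b) u v = ((u == a) && (v == b)) || entry Y u v.
Proof.
rewrite /entry /row /mark nth_set_nth /=; case: eqP => [->|] //=.
by rewrite nth_set_nth /=; case: eqP.
Qed.

Lemma entry_mark2 Y a b u v : entry (mark2 Y a b) u v =
  [|| (u == a) && (v == b), (u == b) && (v == a) | entry Y u v].
Proof. by rewrite /mark2 !entry_mark orbCA. Qed.

Lemma entry_nil a b : entry [::] a b = false.
Proof. by rewrite /entry /row !nth_nil. Qed.

Lemma entry_marks X l u v :
  entry (marks X l) u v = ((u, v) \in l) || ((v, u) \in l) || entry X u v.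
Proof.
elim: l => //= -[a b] l IH; rewrite entry_mark2 IH !inE !xpair_eqE /=.
by rewrite [(v == a) && _]andbC; case: (_ && _); case: (_ && _); case: (_ \in l); case: (_ \in l).
Qed.

Definition symmetric_matrix (Y : matrix) := forall a b, entry Y a b = entry Y b a.

Lemma symmetric_mark2 Y a b : symmetric_matrix Y -> symmetric_matrix (mark2 Y a b).
Proof. by move=> sY u v; rewrite !entry_mark2 sY orbCA ![(v == _) && _]andbC. Qed.

Lemma symmetric_marks Y l : symmetric_matrix Y -> symmetric_matrix (marks Y l).
Proof. by move=> sY; elim: l => //= ab l IH; apply: symmetric_mark2. Qed.

Lemma nth_join_mask m Y b : nth false (foldr join [::] (mask m Y)) b ->
  exists w, nth false m w && entry Y w b.
Proof.
elim: m Y => [|c m IH] [|r Y] /=; rewrite ?nth_nil //.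
case: c => /=; last by move/IH => [w H]; exists w.+1.
by rewrite nth_join => /orP[H|/IH[w H]]; [exists 0 | exists w.+1].
Qed.

Lemma square_walk Y a b : entry (square Y) a b -> exists w, entry Y a w && entry Y w b.
Proof.
rewrite {1}/entry {1}/row /square.
case: (ltnP a (size Y)) => aY; last by rewrite [nth [::] _ a]nth_default ?size_map ?nth_nil.
by rewrite (nth_map [::]) //; apply: nth_join_mask.
Qed.

Lemma alikeP Y a b u : alike Y a b -> u != a -> u != b -> entry Y a u = entry Y b u.
Proof.
move=> /allP A /negbTE ua /negbTE ub.
case: (ltnP u (maxn (size (row Y a)) (size (row Y b)))) => U.
  have /A : u \in iota 0 (maxn (size (row Y a)) (size (row Y b))) by rewrite mem_iota.
  by rewrite -!eqnE in ua ub; rewrite ua ub => /eqP.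
by move: U; rewrite geq_max => /andP[U V]; rewrite /entry !nth_default.
Qed.

Definition swapn (a b i : nat) := if i == a then b else if i == b then a else i.

Lemma swapnK a b : involutive (swapn a b).
Proof.
move=> i; rewrite /swapn; case: (eqVneq i a) => [->|ia]; last case: (eqVneq i b) => [->|ib].
- by rewrite eqxx; case: eqP.
- by rewrite eqxx.
- by rewrite (negbTE ia) (negbTE ib).
Qed.

(** [alike] compares the two rows away from [a] and [b]. The entry at the pair itself is preserved
    by symmetry, and [u != v] keeps off the diagonal. *)
Lemma entry_swapn Y a b u v : symmetric_matrix Y -> alike Y a b -> u != v ->
  entry Y (swapn a b u) (swapn a b v) = entry Y u v.
Proof.
move=> sY A uv; rewrite /swapn.
case: (eqVneq u a) => [ua|ua]; case: (eqVneq v a) => [va|va]; subst => //.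
- by rewrite eqxx in uv.
- by case: (eqVneq v b) => [->|vb]; rewrite ?(sY b a) // (alikeP A).
- case: (eqVneq u b) => [->|ub]; rewrite ?(sY a b) //.
  by rewrite sY -(alikeP A) // sY.
- case: (eqVneq u b) => [ub|ub]; case: (eqVneq v b) => [vb|vb]; subst => //.
  + by rewrite eqxx in uv.
  + by rewrite (alikeP A).
  + by rewrite sY (alikeP A) // sY.
Qed.

Lemma mem_pairs_of s a b : (a, b) \in pairs_of s -> (a \in s) && (b \in s).
Proof.
elim: s => //= x s IH; rewrite mem_cat => /orP[/mapP[y ys [-> ->]]|/IH/andP[A B]].
  by rewrite !inE eqxx ys orbT.
by rewrite !inE A B !orbT.
Qed.

Lemma pairs_of_uniq s a b : uniq s -> (a, b) \in pairs_of s -> a != b.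
Proof.
elim: s => //= x s IH /andP[xs us]; rewrite mem_cat => /orP[/mapP[y ys [-> ->]]|/(IH us)//].
by apply: contraNneq xs => ->.
Qed.

Lemma pairs_of_mem (s : seq nat) a b : a \in s -> b \in s -> a != b ->
  ((a, b) \in pairs_of s) || ((b, a) \in pairs_of s).
Proof.
elim: s => //= x s IH; rewrite !inE !mem_cat => /orP[/eqP->|As] /orP[/eqP->|Bs]; rewrite ?eqxx // => ab.
- by rewrite (map_f (fun y => (x, y))) ?orbT.
- by rewrite [X in _ || X](_ : _ = true) ?orbT // (map_f (fun y => (x, y))).
- by case/orP: (IH As Bs ab) => ->; rewrite ?orbT.
Qed.

Lemma symmetric_graph_of r : symmetric_matrix (graph_of r).
Proof.
elim: r => [|T r IH] /=; first by move=> u v; rewrite !entry_nil.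
exact: (@symmetric_marks _ (pairs_of T)).
Qed.

Lemma graph_of_mem (r : system) a b : all uniq r -> entry (graph_of r) a b ->
  exists2 T, T \in r & [&& a \in T, b \in T & a != b].
Proof.
elim: r => [|T r IH] /=; first by rewrite entry_nil.
case/andP=> uT ur; rewrite -/(marks _ _) entry_marks => /orP[/orP[H|H]|/(IH ur)[U Ur H]].
- exists T; rewrite ?mem_head //; have /andP[-> ->] := mem_pairs_of H; exact: pairs_of_uniq H.
- exists T; rewrite ?mem_head //; have /andP[-> ->] := mem_pairs_of H.
  by rewrite eq_sym /=; apply: pairs_of_uniq H.
- by exists U; rewrite // inE Ur orbT.
Qed.

Lemma mem_graph_of (r : system) (T : seq nat) a b : T \in r -> a \in T -> b \in T -> a != b -> entry (graph_of r) a b.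
Proof.
elim: r => //= U r IH; rewrite inE -/(marks _ _) entry_marks => /orP[/eqP<-|Tr] aT bT ab.
  by rewrite pairs_of_mem.
by rewrite IH ?orbT.
Qed.

Lemma mem_far_sets (fr : rel nat) k s u :
  subseq u s -> size u <= k -> pairwise fr u -> u \in far_sets fr k s.
Proof.
elim: s k u => [|x s IH] k u; first by rewrite subseq0 => /eqP->.
case: u => [|y u] /=; first by case: k => // k _ _ _; rewrite mem_cat IH ?orbT // sub0seq.
case: k => // k; case: eqP => [->|_] S K /andP[A P]; rewrite mem_cat; last by rewrite IH ?orbT //= A.
by rewrite map_f // mem_filter A IH.
Qed.

Lemma pairwise_of_uniq (fr : rel nat) u : uniq u ->
  {in u &, forall x y, x != y -> fr x y} -> pairwise fr u.
Proof.
elim: u => //= x u IH /andP[xu uu] H; apply/andP; split.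
  apply/allP => y yu; apply: H; rewrite ?mem_head ?inE ?yu ?orbT //.
  by apply: contraNneq xu => ->.
by apply: IH => // a b A B; apply: H; rewrite inE ?A ?B orbT.
Qed.

Lemma nth_degrees r x : nth 0 (degrees r) x = count_mem x (flatten r).
Proof.
elim: r => [|T r IH] /=; first by rewrite nth_nil.
rewrite count_cat -IH; elim: T => //= y T IHT.
by rewrite nth_incr_nth IHT addnA.
Qed.

Lemma weightE D T : weight D T = \sum_(x <- T) nth 0 D x.
Proof. by elim: T => [|x T IH] /=; rewrite ?big_nil ?big_cons // -IH. Qed.

Lemma cheapest_mem opts n best zs (P : seq (nat * nat) -> Prop) :
  P best -> (forall z, z \in zs -> P (opts z)) -> P (cheapest opts n best zs).
Proof.
elim: n best zs => [|n IH] best [|z zs] //= Pb H; case: ifP => // _.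
apply: IH; last by move=> w W; apply: H; rewrite inE W orbT.
by case: ifP => // _; apply: H; rewrite mem_head.
Qed.

Lemma colourings_hit Y r z : z \in colourings Y r ->
  (forall T, T \in r -> exists2 x, x \in T & x \in z) /\ {subset z <= flatten r}.
Proof.
elim: r z => [|T r IH] z /=; first by rewrite inE => /eqP->.
case/flattenP => _ /mapP[y Y1 ->]; have [H S] := IH _ Y1.
case: ifP => [/hasP[x xT /hasP[x' X']]|_].
  rewrite inE eqnE => /eqP E /eqP->; subst x'; split=> [U|v /S]; last by rewrite mem_cat orbC => ->.
  by rewrite inE => /orP[/eqP->|/H//]; exists x.
case/mapP => x; rewrite mem_filter => /andP[_ xT] ->; split=> [U|v].
  rewrite inE => /orP[/eqP->|/H[w wU wy]]; first by exists x; rewrite ?mem_head.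
  by exists w; rewrite // inE wy orbT.
by rewrite inE mem_cat => /orP[/eqP->|/S->]; rewrite ?xT ?orbT.
Qed.

Lemma add_new_mem x L : {subset x :: L <= add_new x L}.
Proof.
elim: L => //= y L IH z; case: ifP => [/eqP E2|_]; last first.
  rewrite !inE orbCA => /orP[->//|zz]; by rewrite IH ?orbT // inE.
case: ifP => [/eqP E1|_]; last first.
  rewrite !inE orbCA => /orP[->//|zz]; by rewrite IH ?orbT // inE.
by case: x y E1 E2 {IH} => ? ? [? ?] /= -> ->; rewrite !inE orbA orbb.
Qed.

Lemma next_level_mem (L : seq (nat * system)) (y x : nat * system) : y \in L -> x \in extensions y.1 y.2 -> relabel x \in next_level L.
Proof.
move=> yL xy; rewrite /next_level; move: [::] => L0.
have F (l : seq (nat * system)) : {subset L0 ++ l <= foldl (fun L' x => add_new x L') L0 l}.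
  elim: l L0 => [|a l IH] L0 z /=; first by rewrite cats0.
  rewrite mem_cat inE orbCA => H; apply: IH; rewrite mem_cat.
  case/orP: H => [/eqP->|]; last case/orP=> [zL|->]; rewrite ?orbT //.
    by rewrite add_new_mem ?mem_head.
  by rewrite add_new_mem // inE zL orbT.
apply: F; rewrite mem_cat orbC map_f //.
by apply/flattenP; exists (extensions y.1 y.2) => //; apply: (map_f (fun y => extensions y.1 y.2)).
Qed.

(** * Soundness of the search for a fixed system of triangles *)

Arguments accept : simpl never.
Arguments witness : simpl never.

Section Placement.
Variables (T : finType) (e : rel T).
Hypotheses (eC : symmetric e) (eI : irreflexive e) (sqf : square_free e).

Definition triangle (A : {set T}) : bool :=
  [exists x, exists y, exists z, [&& e x y, e y z, e z x & A == [set x; y; z]]].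

Definition block (g : nat -> T) (B : seq nat) : {set T} := [set v in map g B].

(** The link between the search and a concrete graph: [g] labels vertices by the points of [r] so
    that the blocks become the triangles in [s]. *)
Definition placed p (r : system) (g : nat -> T) (s : seq {set T}) : Prop :=
  [/\ uniq (map g (iota 0 p)),
      all (fun B => uniq B && all (fun i => i < p) B) r
    & perm_eq (map (block g) r) s].

Lemma edge_neq x y : e x y -> x != y.
Proof. by move=> xy; apply/eqP => E; rewrite E eI in xy. Qed.

(** Consecutive vertices differ by irreflexivity, so only the two diagonals have to be checked. *)
Lemma no_square a b c d : a != c -> b != d -> e a b -> e b c -> e c d -> e d a -> False.
Proof.
move=> ac bd ab bc cd da; have := sqf (a := a) (b := b) (c := c) (d := d).
rewrite ac bd ab bc cd da (edge_neq ab) (edge_neq bc) (edge_neq cd) (_ : a != d) => [/(_ isT)//|].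
by rewrite eq_sym edge_neq.
Qed.

Lemma triangleP A : reflect (exists x y z, [/\ e x y, e y z, e z x & A = [set x; y; z]]) (triangle A).
Proof.
apply: (iffP existsP) => [[x /existsP[y /existsP[z /and4P[a b c /eqP d]]]]|[x [y [z [a b c d]]]]].
  by exists x, y, z.
by exists x; apply/existsP; exists y; apply/existsP; exists z; rewrite a b c d eqxx.
Qed.

Lemma triangle_edge A x y : triangle A -> x \in A -> y \in A -> x != y -> e x y.
Proof.
case/triangleP => a [b [c [ab bc ca ->]]]; rewrite !inE.
have [ba cb ac] : [/\ e b a, e c b & e a c] by rewrite !(eC _ a) !(eC c) bc ab; split => //; rewrite eC.
by do 2![case/orP => [/orP[]|] /eqP->]; rewrite ?eqxx.
Qed.

Lemma triangle_third A x y : triangle A -> x \in A -> y \in A -> x != y ->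
  exists2 z, A = [set x; y; z] & e x z && e y z.
Proof.
move=> tA xA yA xy; have exy := triangle_edge tA xA yA xy.
suff [z zA /andP[zx zy]] : exists2 z, A = [set x; y; z] & (z != x) && (z != y).
  exists z => //; have zz : z \in A by rewrite zA !inE eqxx orbT.
  by rewrite !(triangle_edge tA) // eq_sym.
case/triangleP: tA xA yA => a [b [c [/edge_neq ab /edge_neq bc /edge_neq ca ->]]]; rewrite !inE.
have P1 : [set a; b; c] = [set b; a; c] by rewrite (setUC [set a]).
have P2 (u v w : T) : [set u; v; w] = [set u; w; v] by rewrite setUAC.
have P3 (u v w : T) : [set u; v; w] = [set v; u; w] by rewrite (setUC [set u]).
case/orP => [/orP[]|] /eqP E1; case/orP => [/orP[]|] /eqP E2; subst; rewrite ?eqxx // in xy *.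
- by exists c; rewrite // ca eq_sym bc.
- by exists b; rewrite 1?P2 // bc eq_sym ab.
- by exists c; rewrite 1?P3 // ca eq_sym bc.
- by exists a; rewrite ?ab 1?eq_sym ?ca // P3 P2.
- by exists b; rewrite 1?P2 1?P3 1?P2 // ?bc 1?eq_sym ?ab.
- by exists a; rewrite ?ab 1?eq_sym ?ca // P2 P3 P2.
Qed.

Lemma card_triangle A : triangle A -> #|A| = 3.
Proof.
case/triangleP => a [b [c [/edge_neq ab /edge_neq bc /edge_neq ca ->]]].
by rewrite setUC cardsU1 cards2 ab !inE negb_or ca eq_sym bc.
Qed.

Lemma placed_inj p (g : nat -> T) i j : uniq (map g (iota 0 p)) -> i < p -> j < p -> g i = g j -> i = j.
Proof.
move=> U ip jp E; apply/eqP.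
rewrite -(nth_uniq (g 0) _ _ U) ?size_map ?size_iota //.
by rewrite !(nth_map 0) ?size_iota // !nth_iota // !add0n E.
Qed.

Lemma mem_block p (g : nat -> T) i B : uniq (map g (iota 0 p)) -> i < p -> all (fun i => i < p) B ->
  (g i \in block g B) = (i \in B).
Proof.
move=> U ip /allP Bp; rewrite inE; apply/mapP/idP => [[j jB E]|iB]; last by exists i.
by rewrite (placed_inj U ip (Bp _ jB) E).
Qed.

Lemma placed_size p r g s : placed p r g s -> p <= #|T|.
Proof.
case=> U _ _; rewrite -[p](size_iota 0) -(size_map g) cardE.
by apply: uniq_leq_size => // x _; rewrite mem_enum.
Qed.

Lemma placed_bound p r g s B : placed p r g s -> B \in r -> all (fun i => i < p) B.
Proof. by case=> _ /allP H _ /H/andP[]. Qed.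

Lemma placed_uniq p r g s : placed p r g s -> all uniq r.
Proof. by case=> _ /allP H _; apply/allP => B /H/andP[]. Qed.

Lemma placed_in p r g s B : placed p r g s -> B \in r -> block g B \in s.
Proof. by case=> _ _ /perm_mem <-; apply: map_f. Qed.

Definition sound p g (Y : matrix) : Prop :=
  forall a b, entry Y a b -> [/\ a < p, b < p & e (g a) (g b)].

Lemma sound_graph_of p r g s : placed p r g s -> all triangle s -> sound p g (graph_of r).
Proof.
move=> P /allP tri a b /(graph_of_mem (placed_uniq P))[B Br /and3P[aB bB ab]].
have /allP Bp := placed_bound P Br; split; rewrite ?Bp //.
apply: (triangle_edge (tri _ (placed_in P Br))); rewrite ?inE ?map_f //.
by apply: contraNneq ab => /(placed_inj _ (Bp _ aB) (Bp _ bB)) ->; case: P.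
Qed.

(** A walk [a], [w], [v], [b] in [Y] closes up with the edge to a 4-cycle; if a diagonal collapsed,
    the edge would already be in [Y]. Walks of length 2 are excluded by the last hypothesis. *)
Lemma far_edge p g Y a b : uniq (map g (iota 0 p)) -> symmetric_matrix Y -> sound p g Y -> a < p -> b < p ->
  e (g a) (g b) -> ~~ entry Y a b ->
  (forall w, w < p -> entry Y a w -> entry Y b w -> False) -> far Y (square Y) a b.
Proof.
move=> U sY S ap bp eab nY noc; rewrite /far.
have ab : g a != g b by rewrite edge_neq.
case: ifP => [|_]; first by rewrite eqnE => /eqP E; rewrite E eqxx in ab.
rewrite (negbTE nY); case: meetP => [[w /andP[aw bw]]|_].
  by have [_ wp _] := S _ _ aw; case: (noc w).
apply/meetP => -[w /andP[aw /square_walk[v /andP[bv vw]]]].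
have [_ wp ew] := S _ _ aw; have [_ vp ev] := S _ _ bv; have [_ _ evw] := S _ _ vw.
have av : g a != g v.
  by apply/eqP => /(placed_inj U ap vp) E; rewrite -E sY in bv; rewrite bv in nY.
have wb : g w != g b.
  by apply/eqP => /(placed_inj U wp bp) E; rewrite E in aw; case/negP: nY.
by apply: (no_square (a := g a) (b := g w) (c := g v) (d := g b)) => //; rewrite eC.
Qed.

(** * Consequences of uncolourability *)

Hypothesis uncol : ~ colourable101 e.

(** Giving 0 exactly to the vertices of [z] puts a 0 on every triangle, so the assignment can fail
    only through an edge inside [z]. *)
Lemma uncoloured_pair p r g s z : placed p r g s -> (forall A, triangle A -> A \in s) ->
  (forall B, B \in r -> exists2 x, x \in B & x \in z) ->
  exists2 ab, ab \in pairs_of z & e (g ab.1) (g ab.2).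
Proof.
move=> P tri hit.
case: (boolP (has (fun ab => e (g ab.1) (g ab.2)) (pairs_of z))) => [/hasP//|/hasPn no].
case: uncol; exists (fun v => v \notin map g z); split=> [x y xy|x y w xy yw wx].
  rewrite -negb_and; apply: contraTN xy => /andP[/mapP[a az ->] /mapP[b bz ->]].
  case: (eqVneq a b) => [->|ab]; first by rewrite eI.
  by case/orP: (pairs_of_mem az bz ab) => /no //=; rewrite eC.
have tA : triangle [set x; y; w] by apply/triangleP; exists x, y, w.
case: P => _ _ /perm_mem M; move: (tri _ tA); rewrite -M => /mapP[B Br E].
have [a aB az] := hit _ Br.
have : g a \in block g B by rewrite inE map_f.
rewrite -E !inE; case/orP => [/orP[]|] /eqP <-; rewrite map_f //= ?andbF //.
Qed.

(** A common neighbour of [a] and [b] in [Y] would complete a triangle. All triangles are in the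
    system, so the edge would be known already. *)
Lemma known_edge p r g s Y a b : placed p r g s -> (forall A, triangle A -> A \in s) ->
  symmetric_matrix Y -> sound p g Y ->
  (forall a b, entry (graph_of r) a b -> entry Y a b) ->
  a < p -> b < p -> e (g a) (g b) -> entry Y a b || far Y (square Y) a b.
Proof.
move=> P tri sY S base ap bp eab; case: (boolP (entry Y a b)) => //= nY.
have U : uniq (map g (iota 0 p)) by case: P.
apply: (far_edge U) => // w wp aw bw; have [_ _ eaw] := S _ _ aw; have [_ _ ebw] := S _ _ bw.
have tA : triangle [set g a; g b; g w].
  by apply/triangleP; exists (g a), (g b), (g w); split=> //; rewrite eC.
have [_ _ /perm_mem M] := P; move: (tri _ tA); rewrite -M => /mapP[B Br E].
have Bp := placed_bound P Br.
case/negP: nY; apply: base; apply: (mem_graph_of Br).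
- by rewrite -(mem_block U ap Bp) -E !inE eqxx.
- by rewrite -(mem_block U bp Bp) -E !inE eqxx orbT.
- by apply: contraTneq eab => ->; rewrite eI.
Qed.

Definition realizes_witness : Prop :=
  exists2 g : nat -> T, uniq (map g (iota 0 17)) &
    forall a b, a < 17 -> b < 17 -> e (g a) (g b) = entry witness a b.

Lemma acceptP p r g s Y : placed p r g s -> (forall A, triangle A -> A \in s) ->
  symmetric_matrix Y -> sound p g Y ->
  (forall a b, entry (graph_of r) a b -> entry Y a b) ->
  accept p Y -> realizes_witness.
Proof.
move=> P tri sY S base; rewrite /accept; case: ifP => // p17 /allP A.
have U : uniq (map g (iota 0 p)) by case: P.
exists g.
  move: U; rewrite -(subnKC p17) iotaD map_cat cat_uniq; by case/andP.
move=> a b a17 b17; have := A a; rewrite mem_iota => /(_ a17)/allP /(_ b).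
rewrite mem_iota => /(_ b17); case: ifP => // /eqP <- nfar.
apply/idP/idP => [eab|/S[]//].
have := known_edge P tri sY S base (leq_trans a17 p17) (leq_trans b17 p17) eab.
by rewrite (negbTE nfar) orbF.
Qed.

(** A block that contains both points or neither is unchanged as a set by the exchange. *)
Lemma placed_swap p r g s a b : placed p r g s -> a < p -> b < p ->
  all (fun B => (a \in B) == (b \in B)) r -> placed p r (fun i => g (swapn a b i)) s.
Proof.
move=> [U Bp Pm] ap bp /allP tw.
have sp i : i < p -> swapn a b i < p by rewrite /swapn; case: eqP => // _; case: eqP.
split=> //.
  rewrite map_inj_in_uniq ?iota_uniq // => i j; rewrite !mem_iota => ip jp.
  by move/(placed_inj U (sp _ ip) (sp _ jp)) => /(can_inj (swapnK a b)).
suff -> : map (block (fun i => g (swapn a b i))) r = map (block g) r by [].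
apply/eq_in_map => B /tw /eqP E; apply/setP => v; rewrite !inE.
have sB i : (swapn a b i \in B) = (i \in B).
  by rewrite /swapn; case: eqP => [->|_] //; case: eqP => [->|_].
apply/mapP/mapP => -[i iB ->]; first by exists (swapn a b i); rewrite ?sB.
by exists (swapn a b i); rewrite ?sB // swapnK.
Qed.

(** The conclusion is proved for every labelling [g] that fits the node, so that a symmetry of the
    node can be absorbed by composing [g] with a transposition. *)
Lemma solveP p r s tw n Y X zs : solve p tw n Y X zs ->
  (forall A, triangle A = (A \in s)) ->
  (forall ab, ab \in tw -> [/\ ab.1 < p, ab.2 < p, ab.1 != ab.2 &
     all (fun B => (ab.1 \in B) == (ab.2 \in B)) r]) ->
  symmetric_matrix Y -> symmetric_matrix X ->
  (forall a b, entry (graph_of r) a b -> entry Y a b) ->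
  (forall z, z \in zs -> (forall B, B \in r -> exists2 x, x \in B & x \in z) /\
     (forall x, x \in z -> x < p)) ->
  forall g, placed p r g s -> sound p g Y ->
  (forall a b, entry X a b -> ~~ e (g a) (g b)) -> realizes_witness.
Proof.
move=> + tri twP.
elim: n Y X zs => [|n IH] Y X zs; first by discriminate.
case: zs => [|z zs].
  move=> acc sY sX base hit g P S N.
  apply: (acceptP P _ sY S base acc) => A; by rewrite tri.
rewrite /solve -/solve.
move=> + sY sX base hit g P S N.
move Do: (cheapest _ _ _ _) => o.
(* Every listed zero set contains an edge, so the chosen list of options does too, whichever it
   is. *)
have [op edge] : (forall ab, ab \in o -> [&& ab.1 < p, ab.2 < p & ab.1 != ab.2]) /\
    exists2 ab, ab \in o & e (g ab.1) (g ab.2).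
  have opt w : w \in z :: zs -> (forall ab, ab \in options Y (square Y) X w -> [&& ab.1 < p, ab.2 < p & ab.1 != ab.2]) /\
    exists2 ab, ab \in options Y (square Y) X w & e (g ab.1) (g ab.2).
    move/hit => [hw wp]; split=> [[a b]|].
      rewrite mem_filter => /andP[/= ab /mem_pairs_of/andP[/wp -> /wp ->]] /=.
      apply: contraTneq ab => ->; case: ifP => // _.
      by case: ifP => [/S[_ _]|_]; rewrite ?eI // /far eqnE eqxx.
    case: (uncoloured_pair P _ hw) => [A|[a b] ab /= eab]; first by rewrite tri.
    exists (a, b) => //; rewrite mem_filter ab andbT /=.
    case: ifP => [/N|_]; first by rewrite eab.
    have /andP[/wp ap /wp bp] := mem_pairs_of ab.
    have := known_edge P _ sY S base ap bp eab; case: ifP => //= _; apply => A; by rewrite tri.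
  rewrite -Do; apply: (@cheapest_mem _ _ _ _ (fun o => (forall ab, ab \in o -> [&& ab.1 < p, ab.2 < p & ab.1 != ab.2]) /\
    exists2 ab, ab \in o & e (g ab.1) (g ab.2))); first exact: opt (mem_head _ _).
  by move=> w wz; apply: opt; rewrite inE wz orbT.
(* Induction on the options left while [X] grows; the invariant is that one of them is an edge. *)
move: {Do} edge op; elim: o X sX N => [|[a b] o IHo] X sX N [] //= ov ovo eov op.
have /and3P[/= ap bp ab] := op _ (mem_head _ _).
have op' w : w \in o -> [&& w.1 < p, w.2 < p & w.1 != w.2] by move=> H; apply: op; rewrite inE H orbT.
case: ifP => [/N nab|nX].
  apply: IHo => //; move: ovo eov; rewrite inE => /orP[/eqP->|ovo] eov; last by exists ov.
  by rewrite /= (negbTE nab) in eov.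
case: ifP => // child rest.
have sub h : placed p r h s -> sound p h Y -> (forall a b, entry X a b -> ~~ e (h a) (h b)) ->
    e (h a) (h b) -> realizes_witness.
  move=> Ph Sh Nh hab; apply: (IH _ _ _ child) Ph _ Nh => //.
  - exact: symmetric_mark2.
  - by move=> u v /base uv; rewrite entry_mark2 uv !orbT.
  - move=> w W; have {W} : w \in filter (separates a b) (z :: zs) by exact: W.
    by rewrite mem_filter => /andP[_]; apply: hit.
  - move=> u v; rewrite entry_mark2 => /or3P[/andP[/eqP-> /eqP->]|/andP[/eqP-> /eqP->]|/Sh//] //.
    by split=> //; rewrite eC.
(* If the image of the pair under an admissible transposition is an edge, the composed labelling
   makes the pair itself an edge, and [sub] applies. *)
have swap c d c' : (c, d) = (a, b) \/ (d, c) = (a, b) -> (c, c') \in tw -> alike Y c c' -> alike X c c' ->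
    e (g c') (g d) -> realizes_witness.
  move=> cd /twP[/= cp c'p cc' tw'] aY aX ed.
  have ncd : c != d by case: cd => -[-> ->]; rewrite // eq_sym.
  case: (eqVneq c' d) => [E|nc'd]; first by rewrite E eI in ed.
  have hd : swapn c c' d = d by rewrite /swapn !(eq_sym d) (negbTE ncd) (negbTE nc'd).
  have hc : swapn c c' c = c' by rewrite /swapn eqxx.
  apply: (sub (fun i => g (swapn c c' i))).
  - exact: placed_swap.
  - move=> u v uv; have [up vp euv] := S _ _ uv.
    have nuv : u != v by apply: contraTneq euv => ->; rewrite eI.
    have := uv; rewrite -(entry_swapn sY aY nuv) => /S[_ _ ->]; split=> //.
  - move=> u v; case: (eqVneq u v) => [->|nuv]; first by rewrite eI.
    by rewrite -(entry_swapn sX aX nuv) => /N.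
  - by case: cd => -[<- <-]; rewrite hc hd // eC.
case: (boolP (has (fun cd => e (g cd.1) (g cd.2)) ((a, b) :: swap_pairs tw Y X a b ++ swap_pairs tw Y X b a))).
  have pr c d : (c, d) = (a, b) \/ (d, c) = (a, b) ->
      forall uv, uv \in swap_pairs tw Y X c d -> e (g uv.1) (g uv.2) -> realizes_witness.
    move=> cd _ /mapP[[c0 c'] + ->]; rewrite mem_filter /= eqnE; case: eqP => // -> .
    by case: ifP => // aY /andP[aX ctw]; apply: swap ctw aY aX.
  case/hasP => uv; rewrite inE mem_cat => /or3P[/eqP->|uv1|uv1].
  - exact: sub.
  - by apply: pr uv1; left.
  - by apply: pr uv1; right.
(* Otherwise the pair and its images are all non-edges, so [X] may absorb them. *)
move/hasPn => none; apply: (IHo _ _ _ _ op' rest) => //.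
- exact: (@symmetric_marks _ ((a, b) :: _)).
- move=> u v; rewrite [mark2 _ _ _](_ : _ = marks X ((a, b) :: swap_pairs tw Y X a b ++ swap_pairs tw Y X b a)) // entry_marks => /orP[/orP[/none//|/none]|/N//].
  by rewrite eC.
exists ov => //; move: ovo eov; rewrite inE => /orP[/eqP->|//] /= eab.
by have := none _ (mem_head _ _); rewrite /= eab.
Qed.
End Placement.

(** * Completeness of the list of triangle systems *)

Section Levels.
Variables (T : finType) (e : rel T).
Hypotheses (eC : symmetric e) (eI : irreflexive e) (sqf : square_free e).
Hypothesis cardT : #|T| <= 17.

Notation triangle := (triangle e).

(* The invariant form of [weight]. *)
Definition load (s : seq {set T}) (A : {set T}) : nat :=
  \sum_(v in A) count (fun B : {set T} => v \in B) s.

Lemma perm_load s1 s2 A : perm_eq s1 s2 -> load s1 A = load s2 A.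
Proof. by move=> P; apply: eq_bigr => v _; apply/permP. Qed.

Lemma weight_load p r (g : nat -> T) s B : placed p r g s -> B \in r ->
  weight (degrees r) B = load s (block g B).
Proof.
move=> P Br; have [U /allP R Pm] := P; have /andP[uB /allP Bp] := R _ Br.
rewrite -(perm_load _ Pm) weightE /load.
have -> : \sum_(v in block g B) count (fun A : {set T} => v \in A) (map (block g) r)
        = \sum_(v <- map g B) count (fun A : {set T} => v \in A) (map (block g) r).
  rewrite big_uniq; first by apply: eq_bigl => v; rewrite inE.
  by rewrite map_inj_in_uniq // => i j /Bp ip /Bp jp; apply: (placed_inj U).
rewrite big_map; apply: eq_big_seq => x /Bp xp.
rewrite nth_degrees count_map count_flatten sumnE big_map -sum1_count [RHS]big_mkcond.
apply: eq_big_seq => A /R/andP[uA Ap] /=.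
by rewrite count_uniq_mem // (mem_block U xp Ap); case: (_ \in _).
Qed.

Lemma eq_block (g h : nat -> T) B : {in B, g =1 h} -> block g B = block h B.
Proof. by move=> gh; apply/setP => v; rewrite !inE; congr (_ \in _); apply/eq_in_map. Qed.

Lemma placed_relabel x (g : nat -> T) s : placed x.1 x.2 g s ->
  exists g', placed (relabel x).1 (relabel x).2 g' s.
Proof.
case: x => p r /= P; rewrite /relabel; case: ifP => [|_]; last by exists g.
move: (labelling p r) => o; rewrite /is_order eqnE.
case: eqP => // so; case: ifP => // uo /allP op /=.
have mo i : (i \in o) = (i < p).
  have [j||_ ->] := uniq_min_size uo (s2 := iota 0 p); rewrite ?mem_iota ?size_iota ?so //.
  by move/op.
have [U /allP R Pm] := P; exists (fun i => g (nth 0 o i)); split.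
- rewrite (map_comp g) -so -/(mkseq _ _) mkseq_nth.
  rewrite map_inj_in_uniq // => i j; rewrite !mo; exact: (placed_inj U).
- rewrite all_sort all_map; apply/allP => B /R/andP[uB /allP Bp] /=.
  rewrite sort_uniq all_sort all_map map_inj_in_uniq ?uB /=; last first.
    by move=> i j /Bp ip /Bp jp E; rewrite -(nth_index 0 (s := o) (x := i)) ?mo // E nth_index ?mo.
  by apply/allP => i /Bp ip /=; rewrite -so index_mem mo.
- apply: (perm_trans (perm_map _ (permEl (perm_sort _ _)))).
  move: Pm; congr (perm_eq _ _); rewrite -map_comp; apply/eq_in_map => B /R/andP[_ /allP Bp] /=.
  apply/setP => v; rewrite !inE; apply/mapP/mapP => -[i iB ->].
    exists (index i o); last by rewrite nth_index ?mo ?Bp.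
    by rewrite mem_sort; apply: (map_f (index^~ o)).
  move: iB; rewrite mem_sort => /mapP[j jB ->]; exists j => //.
  by rewrite nth_index ?mo ?Bp.
Qed.

(** The labelled points of [A] are pairwise far in the union of the old triangles, and its other
    points get fresh labels. The minimal load of [A] is what the weight test asks for. *)
Lemma extensions_complete p r (g : nat -> T) s A : placed p r g s -> all triangle s -> triangle A ->
  A \notin s -> {in s, forall B, load (A :: s) A <= load (A :: s) B} ->
  exists2 x, x \in extensions p r & exists g', placed x.1 x.2 g' (A :: s).
Proof.
move=> P tri tA nA minA; have [U R Pm] := P.
pose u := [seq i <- iota 0 p | g i \in A].
pose w := [seq v <- enum A | v \notin map g (iota 0 p)].
pose k := 3 - size u.
have up i : i \in u -> i < p by rewrite mem_filter mem_iota => /andP[].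
have uw : uniq w by rewrite filter_uniq ?enum_uniq.
have Auw : perm_eq (map g u ++ w) (enum A).
  apply: uniq_perm; rewrite ?enum_uniq ?cat_uniq ?uw ?andbT //.
    apply/andP; split.
      rewrite map_inj_in_uniq ?filter_uniq ?iota_uniq // => i j /up ip /up jp; exact: (placed_inj U).
    apply/hasPn => v; rewrite mem_filter => /andP[nv _]; apply: contra nv => /mapP[i /up ip ->].
    by rewrite map_f // mem_iota.
  move=> v; rewrite mem_cat mem_filter mem_enum; case: (boolP (v \in A)) => vA; rewrite ?andbT ?andbF ?orbF.
    case: (boolP (v \in map g (iota 0 p))) => [/mapP[i ip E]|]; rewrite ?orbT ?orbF //.
    by apply/mapP; exists i => //; rewrite mem_filter -E vA.
  apply/negbTE; apply: contra vA => /mapP[i]; by rewrite mem_filter => /andP[gA _] ->.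
have szw : size w = k.
  have := perm_size Auw; rewrite -cardE (card_triangle eI tA) size_cat size_map /k => <-.
  by rewrite addKn.
have szu : size u <= 3.
  have := perm_size Auw; rewrite -cardE (card_triangle eI tA) size_cat size_map => <-.
  exact: leq_addr.
(* Labels from [p] on go to the points of [A] that have none yet; [g 0] is a default value. *)
pose g' i := if i < p then g i else nth (g 0) w (i - p).
have g'u : {in iota 0 p, g' =1 g} by move=> i; rewrite mem_iota /g' => /= ->.
have mg' : map g' (iota p k) = w.
  rewrite -[p]addn0 iotaDl -map_comp -szw -[RHS](mkseq_nth (g 0)); apply: eq_map => i /=.
  by rewrite /g' ltnNge leq_addr addKn.
have U' : uniq (map g' (iota 0 (p + k))).
  have -> : map g' (iota 0 (p + k)) = map g (iota 0 p) ++ w.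
    by rewrite iotaD map_cat add0n mg'; congr (_ ++ _); apply/eq_in_map.
  rewrite cat_uniq U uw andbT.
  by apply/hasPn => v; rewrite mem_filter => /andP[].
have T3 : block g' (u ++ iota p k) = A.
  apply/setP => v; rewrite inE map_cat mg' (_ : map g' u = map g u).
    by rewrite (perm_mem Auw) mem_enum.
  by apply/eq_in_map => i /up ip; rewrite g'u ?mem_iota ?add0n //.
have P' : placed (p + k) ((u ++ iota p k) :: r) g' (A :: s).
  split=> //=.
    apply/andP; split.
      rewrite cat_uniq filter_uniq ?iota_uniq //= andbT; apply/andP; split.
        apply/hasPn => i; rewrite mem_iota => /andP[pi _]; apply: contraL pi => /up.
        by rewrite ltnNge.
      rewrite all_cat; apply/andP; split; apply/allP => i; first by move/up => ip; apply: ltn_addr.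
      by rewrite mem_iota => /andP[].
    apply: sub_all R => B /andP[-> /allP Bp] /=; apply/allP => i /Bp ip; exact: ltn_addr.
  rewrite T3 perm_cons; move: Pm; congr (perm_eq _ _); apply/eq_in_map => B Br.
  apply: eq_block => i /(allP (placed_bound P Br)) ip; rewrite g'u ?mem_iota ?add0n //.
have q17 : p + k <= 17 by apply: leq_trans cardT; apply: (placed_size P').
exists (p + k, (u ++ iota p k) :: r); last by exists g'.
rewrite /extensions; apply/flattenP; exists [:: (p + k, (u ++ iota p k) :: r)]; last exact: mem_head.
apply/mapP; exists u; last first.
  rewrite -/k q17 ifT //; apply/allP => B Br.
  have -> : foldr (fun x D => incr_nth D x) (degrees r) (u ++ iota p k) = degrees ((u ++ iota p k) :: r) by [].
  rewrite !(weight_load P') ?mem_head ?inE ?Br ?orbT // T3; apply: minA.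
  have [_ _ /perm_mem <-] := P; rewrite (_ : block g' B = block g B) ?map_f //.
  apply: eq_block => i /(allP (placed_bound P Br)) ip; rewrite g'u ?mem_iota ?add0n //.
have S := sound_graph_of eC P tri.
apply: mem_far_sets => //; first exact: filter_subseq.
apply: pairwise_of_uniq => [|i j iu ju ij]; first by rewrite filter_uniq ?iota_uniq.
have [ip jp] := (up _ iu, up _ ju).
have [iA jA] : g i \in A /\ g j \in A.
  by move: iu ju; rewrite !mem_filter => /andP[-> _] /andP[-> _].
have E : entry [seq [seq far (graph_of r) (square (graph_of r)) a b | b <- iota 0 p] | a <- iota 0 p] i j
    = far (graph_of r) (square (graph_of r)) i j.
  by rewrite /entry /row (nth_map 0) ?size_iota // (nth_map 0) ?size_iota // !nth_iota.
rewrite E {E}.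
have gij : g i != g j by apply: contra ij => /eqP /(placed_inj U ip jp) ->.
have [z Az /andP[iz jz]] := triangle_third eC eI tA iA jA gij.
(* If two points of [A] shared an old triangle, its third vertex would be [c], making that triangle
   [A], or else form a 4-cycle with them and [c]. *)
have adj a b c : a < p -> b < p -> a != b -> c \in A -> A = [set g a; g b; c] -> e (g a) c -> e (g b) c ->
   ~~ entry (graph_of r) a b.
  move=> ap bp ab cA Ac ac bc; apply/negP => /(graph_of_mem (placed_uniq P))[B Br /and3P[aB bB _]].
  have BA := placed_in P Br.
  have tB := allP tri _ BA.
  have gab : g a != g b by apply: contra ab => /eqP /(placed_inj U ap bp) ->.
  have [d Bd /andP[ad bd]] : exists2 d, block g B = [set g a; g b; d] & e (g a) d && e (g b) d.
    by apply: (triangle_third eC eI tB); rewrite ?inE ?map_f.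
  case: (eqVneq c d) => [cd|cd]; first by move: nA; rewrite Ac cd -Bd BA.
  by apply: (no_square eI sqf (a := g a) (b := c) (c := g b) (d := d)); rewrite // eC.
have zA : z \in A by rewrite Az !inE eqxx orbT.
have nij : ~~ entry (graph_of r) i j by apply: (adj i j z).
apply: (far_edge eC eI sqf U) => //.
- exact: symmetric_graph_of.
- exact: (triangle_edge eC tA).
(* An old common neighbour other than [z] gives a 4-cycle; if it is [z], then two points of [A] are
   joined in the old graph, against [adj]. *)
move=> c cp ic jc; have [_ _ eic] := S _ _ ic; have [_ _ ejc] := S _ _ jc.
case: (eqVneq (g c) z) => [cz|cz]; last first.
  by apply: (no_square eI sqf (a := g i) (b := g c) (c := g j) (d := z)); rewrite // eC.
have /negP[] // : ~~ entry (graph_of r) i c.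
apply: (adj i c (g j)) => //.
- by apply: contraTneq eic => ->; rewrite eI.
- by rewrite cz Az setUAC.
- exact: (triangle_edge eC tA).
- by rewrite eC.
Qed.

(** All sets of [t] triangles of the graph are covered, not just the set of all its triangles,
    because the induction deletes triangles. *)
Definition complete t (L : seq (nat * system)) : Prop :=
  forall s, uniq s -> all triangle s -> size s = t ->
  exists2 x, x \in L & exists g : nat -> T, placed x.1 x.2 g s.

(** Delete a triangle of least load, place the remaining [t] triangles, and put it back as an
    extension. *)
Lemma complete_next t L : complete t L -> complete t.+1 (next_level L).
Proof.
move=> C s us tri sz.
have [A0 A0s] : exists A, A \in s by case: s sz {us tri} => // A s _; exists A; apply: mem_head.
have [A As minA] : exists2 A, A \in s & {in s, forall B, load s A <= load s B}.
  by case: (arg_minnP (P := mem s) (load s) A0s) => A As minA; exists A.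
have Ps := perm_to_rem As.
have uA : uniq (A :: rem A s) by rewrite -(perm_uniq Ps).
have tA : all triangle (A :: rem A s) by rewrite -(perm_all _ Ps).
have /andP[nA uR] := uA; have /andP[tA1 tR] := tA.
have [|x xL [g P]] := C (rem A s) uR tR; first by rewrite size_rem // sz.
have [|y yx [g' P']] := extensions_complete P tR tA1 nA.
  move=> B BR; rewrite -!(perm_load _ Ps); apply: minA; exact: mem_rem BR.
have [h Ph] := placed_relabel P'.
exists (relabel y); first exact: next_level_mem xL yx.
by exists h; case: Ph => U R Q; split=> //; rewrite (perm_trans Q) // perm_sym.
Qed.

Hypothesis uncol : ~ colourable101 e.

Lemma twinsP (r : system) ab : ab \in twins r ->
  [/\ exists2 B, B \in r & (ab.1 \in B) && (ab.2 \in B), ab.1 != ab.2 &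
      all (fun B => (ab.1 \in B) == (ab.2 \in B)) r].
Proof.
rewrite mem_filter eqnE; case: eqP => //= /eqP ab' /andP[/allP A].
case/flattenP => _ /mapP[B Br ->] /allpairsP[[a b] [aB bB E]]; subst ab.
have hE c D : has (eqn c) D = (c \in D).
  by rewrite -has_pred1; apply: eq_has => d /=; rewrite eqnE eq_sym.
split=> //; first by exists B; rewrite // aB.
by apply/allP => D /A; rewrite !hE.
Qed.

Lemma solve_systemP x (g : nat -> T) s : solve_system x -> placed x.1 x.2 g s ->
  (forall A, triangle A = (A \in s)) -> realizes_witness e.
Proof.
case: x => p r S P tri; rewrite /solve_system in S; have {}P : placed p r g s := P.
have st : all triangle s by apply/allP => A; rewrite tri.
apply: (solveP eC eI sqf uncol S tri _ _ _ _ _ P) => //.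
- move=> ab /twinsP[[B Br /andP[aB bB]] ab' tw].
  by have /allP Bp := placed_bound P Br; rewrite !Bp.
- exact: symmetric_graph_of.
- by move=> a b; rewrite !entry_nil.
- move=> z; rewrite mem_sort => /colourings_hit[H sub]; split=> // v /sub/flattenP[B Br vB].
  exact: (allP (placed_bound P Br)).
- exact: (sound_graph_of eC P st).
- by move=> a b; rewrite entry_nil.
Qed.

(** The rounds reach the level whose [t] is the number of triangles of the graph; there the placed
    system contains all of them and the search applies. *)
Lemma run_sound n t L : run n L -> complete t L ->
  t <= #|[set A | triangle A]| -> realizes_witness e.
Proof.
elim: n t L => // n IH t L; rewrite [run _ _]/=; case: ifP => // /allP ok R C tn.
pose s := enum [set A | triangle A].
have st A : triangle A = (A \in s) by rewrite mem_enum inE.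
have sz : size s = #|[set A | triangle A]| by rewrite cardE.
have us : uniq s by apply: enum_uniq.
move: tn; rewrite leq_eqVlt => /orP[/eqP tn|tn].
  have [|x xL [g P]] := C s us _ (etrans sz (esym tn)); first by apply/allP => A; rewrite st.
  exact: solve_systemP (ok _ xL) P st.
(* Any [t] of the triangles show that this level is not empty, so [run] goes on. *)
have [| | |x xL _] := C (take t s).
- exact: take_uniq.
- by apply/allP => A /mem_take; rewrite st.
- by rewrite size_takel // sz ltnW.
apply: (IH t.+1 (next_level L)) => //; last exact: complete_next.
by case: L xL R {IH ok C}.
Qed.

Lemma complete_start (x0 : T) : complete 0 [:: (0, [::])].
Proof.
by case=> // _ _ _; exists (0, [::]); rewrite ?mem_head //; exists (fun=> x0).
Qed.

Lemma uncolourable_witness : run 20 [:: (0, [::])] -> realizes_witness e.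
Proof.
case: (pickP T) => [x0 _|T0]; last by case: uncol; exists xpredT; split=> x; have := T0 x.
move=> R; exact: run_sound R (complete_start x0) (leq0n _).
Qed.

End Levels.

(** * The extremal graph *)

Definition extremal : rel 'I_17 := fun i j => entry witness i j.

Definition common (a b : nat) : nat :=
  count (fun c => entry witness a c && entry witness c b) (iota 0 17).

Lemma witnessP x y : entry witness x y -> [&& x < 17, y < 17 & x != y].
Proof.
have B0 : all (fun B => uniq B && all (fun i => i < 17) B) base by vm_compute.
rewrite entry_marks => /orP[/orP[]|/graph_of_mem[|B Bb /and3P[xB yB xy]]].
- by rewrite !inE !xpair_eqE => /orP[] /andP[/eqP-> /eqP->].
- by rewrite !inE !xpair_eqE => /orP[] /andP[/eqP-> /eqP->].
- by apply: sub_all B0 => B /andP[].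
- by have /andP[_ /allP Bp] := allP B0 _ Bb; rewrite !Bp.
Qed.

Lemma symmetric_witness : symmetric_matrix witness.
Proof. exact/symmetric_marks/symmetric_graph_of. Qed.

Lemma extremal_simple : simple_graph extremal.
Proof.
split=> [i j|i]; first exact: symmetric_witness.
by apply/negP => /witnessP; rewrite eqxx !andbF.
Qed.

(** Opposite vertices of a 4-cycle have two common neighbours, so this count rules out 4-cycles. *)
Lemma common_le1 : all (fun a => all (fun b => (a == b) || (common a b <= 1)) (iota 0 17)) (iota 0 17).
Proof. by vm_cast_no_check (erefl true). Qed.

Lemma extremal_square_free : square_free extremal.
Proof.
move=> a b c d /and5P[_ ac _ _ /andP[bd _]]; apply/negP => /and4P[ab bc cd da].
have := allP common_le1 (val a); rewrite mem_iota => /(_ (ltn_ord a))/allP/(_ (val c)).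
rewrite mem_iota => /(_ (ltn_ord c)); rewrite (inj_eq val_inj) (negbTE ac) /= leqNgt => /negP[].
rewrite /common -size_filter -[2]/(size [:: val b; val d]).
apply: uniq_leq_size => [|v]; first by rewrite /= inE (inj_eq val_inj) bd.
rewrite !inE mem_filter mem_iota => /orP[/eqP->|/eqP->].
  by rewrite [entry _ _ _]ab [entry _ _ _]bc ltn_ord.
by rewrite !(symmetric_witness _ d) [entry _ _ _]da symmetric_witness [entry _ _ _]cd ltn_ord.
Qed.

(* Vertex [n] gets colour [b]; [c] lists the colours of [n+1], [n+2], ... *)
Definition clash (n : nat) (b : bool) (c : bitseq) : bool :=
  let later := [seq x <- zip (iota n.+1 (size c)) c | entry witness n x.1] in
  if b then has (fun x => has (fun y => [&& x.2, y.2 & entry witness x.1 y.1]) later) later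
  else has (fun x => ~~ x.2) later.

(** Here [c] colours the vertices from [n] on, and every way to colour those below [n] runs into a
    clash. *)
Fixpoint dead (n : nat) (c : bitseq) : bool :=
  if n is n'.+1 then
    all (fun b => if clash n' b c then true else dead n' (b :: c)) [:: true; false]
  else false.

(** Following the values of a proper [f] downwards never meets a clash, so the descent reaches 0,
    where [dead] is false. *)
Lemma deadP (f : nat -> bool) n :
  (forall x y, entry witness x y -> f x || f y) ->
  (forall x y z, entry witness x y -> entry witness y z -> entry witness x z ->
     ~~ [&& f x, f y & f z]) ->
  dead n [seq f i | i <- iota n (17 - n)] -> n <= 17 -> False.
Proof.
move=> f0 f1; elim: n => // n IH + n17.
rewrite [dead _ _]/=; set c := map _ _; move=> D.
have cE : f n :: c = [seq f i | i <- iota n (17 - n)] by rewrite -subnSK.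
have {D} : (if clash n (f n) c then true else dead n (f n :: c)).
  by move: D; case: (f n) => /= /andP[] // _ /andP[].
case: ifP => [cl _|_]; last by rewrite cE => /IH; apply; apply: ltnW.
have later x : x \in [seq x <- zip (iota n.+1 (size c)) c | entry witness n x.1] ->
    entry witness n x.1 /\ x.2 = f x.1.
  rewrite mem_filter => /andP[-> /(nthP (0, false))[i]]; rewrite size_zip size_iota minnn => ic <-; split=> //.
  rewrite nth_zip ?size_iota //= nth_iota //.
  by move: ic; rewrite size_map size_iota => ic; rewrite (nth_map 0) ?size_iota // nth_iota.
move: cl; rewrite /clash; case fn: (f n).
  case/hasP => x /later[nx fx] /hasP[y /later[ny fy]] /and3P[x2 y2 xy].
  by have := f1 n x.1 y.1 nx xy ny; rewrite fn -fx -fy x2 y2.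
case/hasP => x /later[nx fx] x2; have := f0 _ _ nx; by rewrite fn -fx (negbTE x2).
Qed.

Lemma dead_witness : dead 17 [::].
Proof. by vm_cast_no_check (erefl true). Qed.

Lemma extremal_uncolourable : ~ colourable101 extremal.
Proof.
case=> f [f0 f1].
pose h n := f (inord n : 'I_17).
have W x y : entry witness x y -> extremal (inord x) (inord y).
  by move=> xy; have /and3P[x17 y17 _] := witnessP xy; rewrite /extremal !inordK.
apply: (deadP (f := h) _ _ dead_witness) => // [x y /W/f0//|x y z /W xy /W yz /W xz].
by apply: f1 => //; have [eC _] := extremal_simple; rewrite eC.
Qed.

Lemma run_ok : run 20 [:: (0, [::])].
Proof. by vm_cast_no_check (erefl true). Qed.

(** The copy of [witness] occupies 17 distinct vertices, so there are no others and the inverse of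
    the labelling is an isomorphism. *)
Lemma uncolourable_iso (T : finType) (e : rel T) :
  #|T| <= 17 -> simple_graph e -> square_free e -> ~ colourable101 e ->
  #|T| = 17 /\ graph_iso e extremal.
Proof.
move=> cT [eC eI] sqf uncol.
have [g U ge] := uncolourable_witness eC eI sqf cT uncol run_ok.
pose h (i : 'I_17) := g i.
have hI : injective h by move=> i j E; apply: val_inj; exact: (placed_inj U (ltn_ord i) (ltn_ord j) E).
have T17 : #|T| = 17.
  by apply/eqP; rewrite eqn_leq cT -{1}(card_ord 17) (leq_card _ hI).
have [k hk kh] : bijective h by apply: inj_card_bij => //; rewrite card_ord T17.
split=> //; exists k; split=> [|x y]; first by exists h.
by rewrite /extremal -ge // -!/(h _) !kh.
Qed.

(** There are finitely many assignments. This turns the refutation of uncolourability into an actual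
    colouring. *)
Lemma colourable101_dec (T : finType) (e : rel T) : decidable (colourable101 e).
Proof.
pose good (f : {ffun T -> bool}) :=
  [forall x, forall y, e x y ==> f x || f y] &&
  [forall x, forall y, forall z, [&& e x y, e y z & e z x] ==> ~~ [&& f x, f y & f z]].
case: (pickP good) => [f /andP[/'forall_forallP f0 /forallP f1]|no].
  left; exists f; split=> [x y|x y z xy yz zx]; first exact: implyP (f0 x y).
  by have /'forall_forallP/(_ y z)/implyP := f1 x; apply; rewrite xy yz.
right=> -[f [f0 f1]]; have /negP[] := negbT (no (finfun f)); apply/andP; split.
  by apply/'forall_'forall_implyP => x y xy; rewrite !ffunE f0.
apply/forallP => x; apply/'forall_'forall_implyP => y z /and3P[xy yz zx].
by rewrite !ffunE f1.
Qed.

Theorem mainTheorem12 :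
  (forall (T : finType) (e : rel T),
      #|T| <= 16 -> simple_graph e -> square_free e -> colourable101 e)
  /\
  (exists e0 : rel 'I_17,
      [/\ simple_graph e0, square_free e0, ~ colourable101 e0 &
          forall (T : finType) (e : rel T),
            #|T| = 17 -> simple_graph e -> square_free e -> ~ colourable101 e ->
            graph_iso e e0]).
Proof.
split=> [T e cT se sq|]; last first.
  exists extremal; split; first exact: extremal_simple.
  - exact: extremal_square_free.
  - exact: extremal_uncolourable.
  - by move=> T e cT se sq unc; apply: (uncolourable_iso _ se sq unc).2; rewrite cT.
case: (colourable101_dec e) => // unc.
by have := cT; rewrite (uncolourable_iso (leqW cT) se sq unc).1.
Qed.
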